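(* Let $\mathcal{H}$ be a complex separable Hilbert space, let $\mathcal{K}$ and $\mathcal{E}$ be complex Krein spaces, let $T:\mathcal{H}\to\mathcal{K}$ and $V:\mathcal{H}\to\mathcal{E}$ be bounded surjective linear operators, and let $\rho\in\mathbb{R}$, $\rho\neq0$. Let $L:\mathcal{H}\to\mathcal{K}\times\mathcal{E}$, $Lx=(Tx,Vx)$, and suppose that $R(L)$ is a nonnegative subspace of $(\mathcal{K}\times\mathcal{E},[\cdot,\cdot]_\rho)$. Then the following conditions hold: (1) for every $z_0\in\mathcal{E}$ such that $sm(\rho,z_0)\neq\varnothing$ there exists $w_0\in\mathcal{E}$ such that $\varnothing\neq sp(w_0)\subseteq sm(\rho,z_0)$; (2) for every $w_0\in\mathcal{E}$ such that $sp(w_0)\neq\varnothing$ there exists $z_0\in\mathcal{E}$ such that $sp(w_0)\subseteq sm(\rho,z_0)$.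
   Context: A Krein space is a complex vector space $\mathcal{F}$ with a Hermitian sesquilinear form $[\cdot,\cdot]_{\mathcal{F}}$ that admits a fundamental decomposition $\mathcal{F}=\mathcal{F}_+\dotplus\mathcal{F}_-$, where $\mathcal{F}_+$ and $\mathcal{F}_-$ are orthogonal with respect to $[\cdot,\cdot]_{\mathcal{F}}$ and $(\mathcal{F}_+,[\cdot,\cdot])$, $(\mathcal{F}_-,-[\cdot,\cdot])$ are Hilbert spaces. Topological notions refer to the norm of the Hilbert space direct sum of these two spaces (the topology does not depend on the decomposition). $\mathcal{K}\times\mathcal{E}$ carries the indefinite inner product $[(y,z),(y',z')]_\rho=[y,y']_{\mathcal{K}}+\rho[z,z']_{\mathcal{E}}$, which makes it a Krein space since $\rho\ne0$. $R(\cdot)$ denotes the range. A subspace $\mathcal{M}$ is nonnegative if $[x,x]\ge0$ for all $x\in\mathcal{M}$. For $z_0\in\mathcal{E}$, $sm(\rho,z_0)$ is the set of $(T,V,\rho)$-smoothing splines to $z_0$: the set of all $\tilde x\in\mathcal{H}$ at which $\min_{x\in\mathcal{H}}\left([Tx,Tx]_{\mathcal{K}}+\rho[Vx-z_0,Vx-z_0]_{\mathcal{E}}\right)$ is attained (empty if there is no minimum). For $w_0\in\mathcal{E}$, $sp(w_0)$ is the set of $(T,V)$-interpolating splines to $w_0$: the set of all $\tilde x\in\mathcal{H}$ with $V\tilde x=w_0$ at which $\min\{[Tx,Tx]_{\mathcal{K}}: x\in\mathcal{H},\ Vx=w_0\}$ is attained (empty if there is no minimum). *)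

(* Defs.v *)
From HB Require Import structures.
From mathcomp Require Import all_boot all_order all_algebra sesquilinear.
From mathcomp Require Import complex.
From mathcomp Require Import boolp classical_sets functions cardinality.
From mathcomp Require Import reals topology normedtype.

Set Implicit Arguments.
Unset Strict Implicit.
Unset Printing Implicit Defensive.

Import Order.TTheory GRing.Theory Num.Theory.
Import numFieldNormedType.Exports.

Local Open Scope classical_set_scope.
Local Open Scope ring_scope.
Local Open Scope complex_scope.

(* In R[i], [a <= b] means that b - a is real and nonnegative. All the
   quantities compared below are real: they are norms, or diagonal values
   [f x x] of Hermitian forms. *)

Notation "{ 'herm' U }" := {hermitian_sym U for Num.conj}
  (format "{ 'herm'  U }") : ring_scope.

Definition separable (X : topologicalType) :=
  exists2 D : set X, countable D & dense D.

(* The completeness of H is part of its type. *)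
Definition hilbert_space (R : realType) (H : completeNormedModType R[i])
    (dot : {dot H for Num.conj}) :=
  forall x : H, `|x| ^+ 2 = dot x x.

Section Forms.
Variables (R : realType) (F : lmodType R[i]).
Implicit Types (f : F -> F -> R[i]) (M : set F).

Definition subspace M :=
  M 0 /\ forall (a : R[i]) (x y : F), M x -> M y -> M (a *: x + y).

Definition positive_definite f M :=
  forall x, M x -> x != 0 -> 0 < f x x.

(* Cauchy and convergent sequences for the norm x |-> sqrt (f x x) on M. *)
Definition form_cauchy f (u : nat -> F) :=
  forall e : R[i], 0 < e -> exists N : nat, forall m n : nat,
    (N <= m)%N -> (N <= n)%N -> f (u m - u n) (u m - u n) < e ^+ 2.

Definition form_cvg f (u : nat -> F) (l : F) :=
  forall e : R[i], 0 < e -> exists N : nat, forall n : nat,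
    (N <= n)%N -> f (u n - l) (u n - l) < e ^+ 2.

Definition form_complete f M :=
  forall u : nat -> F, (forall n, M (u n)) -> form_cauchy f u ->
    exists2 l, M l & form_cvg f u l.

(* f is meant to be Hermitian and sesquilinear. *)
Definition hilbert_subspace f M :=
  [/\ subspace M, positive_definite f M & form_complete f M].

Definition nonnegative_subspace f M :=
  subspace M /\ forall x, M x -> 0 <= f x x.

Definition fundamental_decomposition (f : {herm F}) (Fp Fm : set F) :=
  [/\ hilbert_subspace f Fp,
      hilbert_subspace (fun x y => - f x y) Fm,
      forall xp xm, Fp xp -> Fm xm -> f xp xm = 0,
      Fp `&` Fm = [set 0] &
      forall x, exists xp xm, [/\ Fp xp, Fm xm & x = xp + xm]].

End Forms.

(* A Krein space is carried here by a normed module: its norm is required to be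
   the norm of the Hilbert space direct sum given by some fundamental
   decomposition. All such norms on F are equivalent, so that the choice of one
   of them does not affect which operators are bounded. *)
Definition krein_space (R : realType) (F : normedModType R[i]) (f : {herm F}) :=
  exists Fp Fm : set F, fundamental_decomposition f Fp Fm /\
    forall xp xm, Fp xp -> Fm xm ->
      `|xp + xm| ^+ 2 = f xp xp - f xm xm.

Definition bounded_operator (R : realType) (U W : normedModType R[i])
    (A : {linear U -> W}) :=
  exists M : R[i], forall x : U, `|A x| <= M * `|x|.

Section Splines.
Variables (R : realType) (H K E : lmodType R[i]).
Variables (fK : {herm K}) (fE : {herm E}).
Variables (T : {linear H -> K}) (V : {linear H -> E}) (rho : R).

Definition product_form (p q : K * E) : R[i] :=
  fK p.1 q.1 + rho%:C * fE p.2 q.2.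

Definition pair_operator (x : H) : K * E := (T x, V x).

Definition smoothing_functional (z0 : E) (x : H) : R[i] :=
  fK (T x) (T x) + rho%:C * fE (V x - z0) (V x - z0).

Definition smoothing_splines (z0 : E) : set H :=
  [set x | forall y : H, smoothing_functional z0 x <= smoothing_functional z0 y].

Definition interpolating_splines (w0 : E) : set H :=
  [set x | V x = w0 /\
    forall y : H, V y = w0 -> fK (T x) (T x) <= fK (T y) (T y)].

End Splines.

(* Main.v *)
(* Part (1): a smoothing spline x is an interpolating spline to V x, and the
   smoothing functional is constant on the interpolating splines to V x.
   Part (2): if x0 is an interpolating spline to w0, then [Tx, Tx0] vanishes for
   x in the kernel of V, so it has the form [Vx, e] for some e in E, because V is
   bounded and surjective (closed range theorem).  With z0 = w0 + e / rho the
   first variation at x0 of the smoothing functional vanishes, and x0 is a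
   minimizer because the quadratic part [Lx, Lx]_rho is nonnegative.
   Only real parts of the forms matter, so the functional analysis is done over
   the reals, with the Krein space E reduced to a real form b, a norm n, and a
   duality between them. *)

Require Import Defs.
From HB Require Import structures.
From mathcomp Require Import all_boot all_order all_algebra sesquilinear.
From mathcomp Require Import complex.
From mathcomp Require Import boolp classical_sets functions cardinality.
From mathcomp Require Import reals topology normedtype.
From mathcomp Require Import ring lra.

Set Implicit Arguments.
Unset Strict Implicit.
Unset Printing Implicit Defensive.

Import Order.TTheory GRing.Theory Num.Theory.
Import numFieldNormedType.Exports.

Local Open Scope classical_set_scope.
Local Open Scope ring_scope.
Local Open Scope complex_scope.

(** * Elementary inequalities over the reals *)

Section RealInequalities.
Variable R : realType.
Implicit Types a b c z : R.

Lemma discriminant_le a b c : 0 <= a ->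
  (forall t, 0 <= t ^+ 2 * a + 2 * t * b + c) -> b ^+ 2 <= a * c.
Proof.
rewrite le0r => /orP[/eqP-> |a0] pos.
  have [->|b0] := eqVneq b 0; first by rewrite expr0n /= mul0r.
  (* For [a = 0] the polynomial is affine in [t] and takes the value -1 at this point. *)
  have := pos (- (c + 1) / (2 * b)).
  have -> : 2 * (- (c + 1) / (2 * b)) * b = - (c + 1) by field.
  by nra.
have := pos (- b / a).
have -> : (- b / a) ^+ 2 * a + 2 * (- b / a) * b + c = (a * c - b ^+ 2) / a.
  by field; rewrite gt_eqF.
by rewrite pmulr_lge0 ?invr_gt0 // subr_ge0.
Qed.

Lemma sqr_small_eq0 z c : (forall e, 0 < e -> z ^+ 2 <= e * c) -> z = 0.
Proof.
move=> zc; apply/eqP; rewrite -sqrf_eq0; apply/eqP/le_anti.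
rewrite sqr_ge0 andbT; apply/ler_addgt0Pr => d d0; rewrite add0r.
have c1 : 0 < `|c| + 1 by rewrite ltr_pwDr.
apply: (le_trans (zc (d / (`|c| + 1)) _)); first by rewrite divr_gt0.
by rewrite mulrAC ler_pdivrMr // ler_pM2l // (le_trans (ler_norm c)) // lerDl.
Qed.

Lemma invS_lt (e : R) : 0 < e -> exists N, forall n, (N <= n)%N -> n.+1%:R^-1 < e.
Proof.
move=> e0; exists (Num.truncn e^-1) => n Nn.
rewrite -[ltRHS]invrK ltf_pV2 ?posrE ?invr_gt0 ?ltr0Sn //.
rewrite (lt_le_trans (truncnS_gt _)) // ler_nat ltnS //.
Qed.

End RealInequalities.

(** * Semidefinite symmetric forms over the reals and Riesz representation *)

Section RealForms.
Variables (R : realType) (U : lmodType R).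
Implicit Types (n : U -> R) (B : U -> U -> R) (M : set U) (u : nat -> U).

(** The gauge is a norm in some uses and a squared norm [B x x] in others; a norm and its square
    have the same Cauchy and convergent sequences. *)
Definition gauge_cauchy n u :=
  forall e : R, 0 < e -> exists N, forall j k, (N <= j)%N -> (N <= k)%N ->
    n (u j - u k) < e.

Definition gauge_cvg n u l :=
  forall e : R, 0 < e -> exists N, forall k, (N <= k)%N -> n (u k - l) < e.

Definition gauge_complete n M :=
  forall u, (forall k, M (u k)) -> gauge_cauchy n u ->
    exists2 l, M l & gauge_cvg n u l.

Definition real_subspace M :=
  M 0 /\ forall (a : R) x y, M x -> M y -> M (a *: x + y).

Definition symmetric_bilinear B :=
  (forall x y, B x y = B y x) /\ forall z, scalar (B ^~ z).

Section SymmetricForm.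
Variables (B : U -> U -> R) (symB : symmetric_bilinear B).

Lemma symfC x y : B x y = B y x. Proof. exact: symB.1. Qed.
Lemma symfDl x y z : B (x + y) z = B x z + B y z.
Proof. by have := symB.2 z 1 x y; rewrite scale1r mul1r. Qed.
Lemma symf0l z : B 0 z = 0.
Proof. by have := symfDl 0 0 z; rewrite addr0; lra. Qed.
Lemma symfZl a x z : B (a *: x) z = a * B x z.
Proof. by have := symB.2 z a x 0; rewrite addr0 symf0l addr0. Qed.
Lemma symfNl x z : B (- x) z = - B x z.
Proof. by rewrite -scaleN1r symfZl mulN1r. Qed.
Lemma symfBl x y z : B (x - y) z = B x z - B y z.
Proof. by rewrite symfDl symfNl. Qed.
Lemma symfDr x y z : B x (y + z) = B x y + B x z.
Proof. by rewrite !(symfC x) symfDl. Qed.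
Lemma symfZr a x z : B x (a *: z) = a * B x z.
Proof. by rewrite !(symfC x) symfZl. Qed.
Lemma symfBr x y z : B x (y - z) = B x y - B x z.
Proof. by rewrite !(symfC x) symfBl. Qed.
Lemma symfNr x y : B x (- y) = - B x y.
Proof. by rewrite !(symfC x) symfNl. Qed.

Variables (M : set U) (subM : real_subspace M).
Hypothesis posB : forall x, M x -> 0 <= B x x.

Lemma real_subspaceB x y : M x -> M y -> M (x - y).
Proof. by move=> Mx My; rewrite addrC -scaleN1r; exact: subM.2. Qed.

Lemma symf_cauchy_schwarz x y : M x -> M y -> B x y ^+ 2 <= B x x * B y y.
Proof.
move=> Mx My; apply: discriminant_le => [|t]; first exact: posB.
have := posB (subM.2 t _ _ Mx My).
by rewrite !(symfDl, symfDr, symfZl, symfZr) (symfC y x); lra.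
Qed.

(* Riesz: minimize x |-> B x x - 2 phi x over M.  The first variation of this
   functional at a minimizer up to d is at most sqrt d, which makes a minimizing
   sequence Cauchy and its limit a representative of phi. *)
Lemma riesz_representation (phi : U -> R) (C : R) :
  gauge_complete (fun x => B x x) M -> scalar phi -> 0 <= C ->
  (forall x, M x -> phi x ^+ 2 <= C * B x x) ->
  exists2 l, M l & forall x, M x -> phi x = B x l.
Proof.
move=> complM linphi C0 phiC; pose J x := B x x - 2 * phi x.
have phiE a x y : phi (a *: x + y) = a * phi x + phi y := linphi a x y.
have JC x : M x -> - C <= J x.
  move=> Mx; have := phiC _ Mx; have := posB Mx; rewrite /J; set q := B x x.
  set p := phi x => q0 pq; rewrite leNgt; apply/negP => Jlt.
  (* [Jlt] says 2p > q + C >= 0, hence 4p^2 > (q + C)^2 >= 4Cq, against [pq]. *)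
  have : 0 < (2 * p - (q + C)) * (2 * p + (q + C)) by rewrite mulr_gt0; lra.
  have := sqr_ge0 (q - C); lra.
pose m := inf (J @` M).
have infJ : has_inf (J @` M).
  split; first by exists (J 0); exists 0 => //; exact: subM.1.
  by exists (- C) => _ [x Mx <-]; exact: JC.
have mJ x : M x -> m <= J x.
  by move=> Mx; apply: ge_inf; [exact: infJ.2 | exists x].
have /choice[v vP] : forall k, exists x, M x /\ J x < m + k.+1%:R^-1.
  move=> k; have k0 : 0 < k.+1%:R^-1 :> R by rewrite invr_gt0 ltr0Sn.
  by have [_ [x Mx <-] Jx] := inf_adherent k0 infJ; exists x.
have Mv k : M (v k) by case: (vP k).
(* For all [t], [J (t *: h + v k) >= m > J (v k) - 1/(k+1)]; the resulting nonnegative quadratic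
   polynomial in [t] has [B h (v k) - phi h] as half its linear coefficient. *)
have var k h : M h -> (B h (v k) - phi h) ^+ 2 <= k.+1%:R^-1 * B h h.
  move=> Mh; rewrite mulrC; apply: discriminant_le => [|t]; first exact: posB.
  have := mJ _ (subM.2 t _ _ Mh (Mv k)); have := (vP k).2; rewrite /J phiE.
  by rewrite !(symfDl, symfDr, symfZl, symfZr) (symfC (v k) h); set d := _ k.+1%:R; lra.
(* For [h = v j - v k], [B h h] is the difference of the first variations at [v j] and [v k] along
   [h], so [var] bounds its square by 2 (1/(j+1) + 1/(k+1)) [B h h]. *)
have vC j k : B (v j - v k) (v j - v k) <= 2 * (j.+1%:R^-1 + k.+1%:R^-1).
  set h := v j - v k; have Mh : M h by exact: real_subspaceB.
  have := var j _ Mh; have := var k _ Mh; have := posB Mh.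
  have : B h h = B h (v j) - B h (v k) by rewrite -symfBr.
  set q := B h h; set dj := _ j.+1%:R; set dk := _ k.+1%:R; set p := phi h.
  move=> qE; rewrite le0r => /orP[/eqP-> _ _|q0 pk pj].
    by rewrite mulr_ge0 // addr_ge0 // invr_ge0 ler0n.
  rewrite -(ler_pM2r q0); apply: le_trans (_ : q ^+ 2 <= _); first by rewrite expr2.
  have := sqr_ge0 ((B h (v j) - p) + (B h (v k) - p)); rewrite qE in pj pk *; nra.
have [|l Ml vl] := complM v Mv.
  move=> e e0; have [|N NP] := @invS_lt _ (e / 4); first by rewrite divr_gt0.
  exists N => j k /NP jN /NP kN; apply: (le_lt_trans (vC j k)).
  by move: jN kN; set dj := _ j.+1%:R; set dk := _ k.+1%:R; lra.
exists l => // h Mh; apply/eqP; rewrite -subr_eq0; apply/eqP.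
apply: (@sqr_small_eq0 _ _ (B h h)) => e e0.
have e4 : 0 < e / 4 by rewrite divr_gt0.
have [N NP] := invS_lt e4; have [N' N'P] := vl _ e4.
pose k := maxn N N'.
have := NP k (leq_maxl _ _); have := N'P k (leq_maxr _ _) => kl kN.
have := var k _ Mh; have Mkl := real_subspaceB (Mv k) Ml.
have := symf_cauchy_schwarz Mh Mkl; rewrite symfBr.
have q0 := posB Mh; have r0 := posB Mkl.
set q := B h h in q0 *; set r := B _ _ in kl r0 *; set d := _ k.+1%:R in kN *.
set p := phi h; set s := B h (v k); set t := B h l => st sp.
have sp' : (s - p) ^+ 2 <= e / 4 * q by apply: (le_trans sp); rewrite ler_wpM2r // ltW.
have st' : (s - t) ^+ 2 <= e / 4 * q.
  by apply: (le_trans st); rewrite mulrC ler_wpM2r // ltW.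
have := sqr_ge0 ((s - p) + (s - t)); nra.
Qed.

End SymmetricForm.
End RealForms.

(** * Uniform boundedness and the closed range theorem for a Krein form *)

Section KreinNorm.
Variables (R : realType) (W : lmodType R).

(* The fourth axiom is witnessed by the fundamental symmetry. *)
Record krein_norm (b : W -> W -> R) (n : W -> R) : Prop := KreinNorm {
  knormD : forall x y, n (x + y) <= n x + n y;
  knormZ : forall a x, n (a *: x) = `|a| * n x;
  knorm_eq0 : forall x, n x = 0 -> x = 0;
  knorm_symmetry : forall e, exists y, n y = n e /\ b y e = n e ^+ 2;
  knorm_form : forall x y, `|b x y| <= n x * n y;
  knorm_complete : gauge_complete n [set: W] }.

Variables (b : W -> W -> R) (n : W -> R).
Hypotheses (symb : symmetric_bilinear b) (nP : krein_norm b n).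

Lemma knorm0 : n 0 = 0.
Proof. by rewrite -(scale0r 0) (knormZ nP) normr0 mul0r. Qed.

Lemma knormN x : n (- x) = n x.
Proof. by rewrite -scaleN1r (knormZ nP) normrN1 mul1r. Qed.

Lemma knorm_dist x y : n (x - y) = n (y - x).
Proof. by rewrite -knormN opprB. Qed.

Lemma knorm_ge0 x : 0 <= n x.
Proof. by have := knormD nP x (- x); rewrite subrr knormN knorm0; lra. Qed.

Lemma knormB_le x y z : n (x - z) <= n (x - y) + n (y - z).
Proof. by have := knormD nP (x - y) (y - z); rewrite addrA subrK. Qed.

(* Sokal's argument for the uniform boundedness principle: y is the sum of the
   vectors of norm 3 ^- k dual to e k, their signs being chosen so that the k-th
   partial sum pairs with e k to at least 3 ^- k * n (e k); the remaining terms
   can only cancel half of this. *)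
Lemma gliding_hump (e : nat -> W) : (forall k, 0 < n (e k)) ->
  exists y, forall k, n (e k) <= 2 * 3 ^+ k * `|b y (e k)|.
Proof.
move=> e0; have [J JP] := choice (knorm_symmetry nP).
pose t k y : R := (if 0 <= b y (e k) then 1 else -1) / (3 ^+ k * n (e k)).
pose Y := fix Y k := if k is j.+1 then Y j + t j (Y j) *: J (e j) else 0.
have YS k : Y k.+1 = Y k + t k (Y k) *: J (e k) by [].
have p3 k : 0 < 3 ^+ k :> R by rewrite exprn_gt0.
have nt k y : `|t k y| = (3 ^+ k * n (e k))^-1.
  rewrite /t normrM; case: ifP => _;
    by rewrite ?normrN normr1 mul1r ger0_norm // invr_ge0 mulr_ge0 ?knorm_ge0 ?ltW.
have Ystep k : n (Y k.+1 - Y k) <= (3 ^+ k)^-1.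
  rewrite YS addrC addKr (knormZ nP) nt (JP _).1 invfM -mulrA mulVf ?mulr1 //.
  by rewrite gt_eqF.
have Ytail k j : n (Y (k + j)%N - Y k) <= 3 / 2 * (3 ^+ k)^-1.
  (* Strengthened for the induction: the right side is the sum of 3^-i over k <= i < k + j. *)
  have : n (Y (k + j)%N - Y k) <= 3 / 2 * ((3 ^+ k)^-1 - (3 ^+ (k + j))^-1).
    elim: j => [|j IH]; first by rewrite addn0 !subrr knorm0 mulr0.
    apply: le_trans (knormB_le _ (Y (k + j)%N) _) _.
    have := Ystep (k + j)%N; rewrite addnS exprS invfM; lra.
  move=> /le_trans; apply; rewrite ler_pM2l; last by lra.
  by rewrite gerBl invr_ge0 ltW.
have Yhump k : n (e k) <= 3 ^+ k * `|b (Y k.+1) (e k)|.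
  rewrite YS (symfDl symb) (symfZl symb) (JP _).2 /t; set s := b (Y k) (e k).
  have -> : forall c, c / (3 ^+ k * n (e k)) * n (e k) ^+ 2 = c * (n (e k) / 3 ^+ k).
    by move=> c; field; rewrite !gt_eqF.
  rewrite -ler_pdivrMl // mulrC; have := divr_gt0 (e0 k) (p3 k).
  set d := _ / _ => d0; case: ifP => s0; first by rewrite ger0_norm; lra.
  by move/negbT: s0; rewrite -ltNge => s0; rewrite ler0_norm; lra.
have Ycauchy : gauge_cauchy n Y.
  move=> d d0; have [|N NP] := @invS_lt R (d / 3); first by rewrite divr_gt0.
  have N3 : (3 ^+ N)^-1 < d / 3.
    apply: le_lt_trans (NP N (leqnn N)); rewrite lef_pV2 ?posrE ?ltr0Sn //.
    by rewrite -natrX ler_nat ltn_expl.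
  exists N => j k Nj Nk; apply: le_lt_trans (knormB_le _ (Y N) _) _.
  have := Ytail N (j - N)%N; have := Ytail N (k - N)%N; rewrite !subnKC //.
  by rewrite (knorm_dist (Y k)); lra.
have [y _ Yy] := knorm_complete nP (fun=> I) Ycauchy.
exists y => k.
(* This bound is half of the 3^-k gained at step [k]. *)
have yY : n (y - Y k.+1) <= 3 / 2 * (3 ^+ k.+1)^-1.
  apply/ler_addgt0Pr => d d0; have [N NP] := Yy _ d0.
  apply: le_trans (knormB_le _ (Y (k.+1 + N)%N) _) _.
  have := Ytail k.+1 N; have := NP (k.+1 + N)%N (leq_addl _ _).
  by rewrite (knorm_dist y); lra.
have yYb : `|b (y - Y k.+1) (e k)| <= (2 * 3 ^+ k)^-1 * n (e k).
  apply: (le_trans (knorm_form nP _ _)); rewrite ler_wpM2r ?knorm_ge0 //.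
  by apply: (le_trans yY); rewrite exprS !invfM; lra.
have : `|b (Y k.+1) (e k)| <= `|b y (e k)| + `|b (y - Y k.+1) (e k)|.
  by rewrite -{1}(subKr y (Y k.+1)) (symfBl symb) ler_normB.
have := Yhump k; rewrite -ler_pdivrMl // => h1 h2.
have : (3 ^+ k)^-1 * n (e k) <= `|b y (e k)| + (2 * 3 ^+ k)^-1 * n (e k) by lra.
rewrite invfM -ler_pdivrMl ?mulr_gt0 // invfM; lra.
Qed.

Variables (U : lmodType R) (B : U -> U -> R).
Hypotheses (symB : symmetric_bilinear B) (posB : forall x, 0 <= B x x).
Hypothesis complB : gauge_complete (fun x => B x x) [set: U].
Variable A : U -> W.
Hypotheses (linA : linear A) (surjA : forall y, exists x, A x = y).

(** The adjoint of [A] sends [e] to [h]. It is a relation because [B] is only semidefinite, so that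
    [e] need not determine [h]. *)
Definition adjoint_rel e h := forall x, b (A x) e = B x h.

Let subT : real_subspace [set: U]. Proof. by []. Qed.

Lemma form_cauchy_schwarz x y : B x y ^+ 2 <= B x x * B y y.
Proof. by apply: (symf_cauchy_schwarz symB subT) => // z _; exact: posB. Qed.

(** Surjectivity of [A] bounds its adjoint below. Otherwise there are [e k] with images [h k] under
    the adjoint such that [n (e k)] exceeds 2 * 3^k * (k+1) times the seminorm of [h k]. The vector
    given by [gliding_hump] is some [A x], and Cauchy-Schwarz for [B x (h k)] yields (k+1)^2 <=
    [B x x] for every [k]. *)
Lemma adjoint_bounded_below : exists C : R, 0 <= C /\
  forall e h, adjoint_rel e h -> n e ^+ 2 <= C * B h h.
Proof.
apply: contrapT => nC.
have /choice[s sP] : forall k : nat, exists s : W * U, adjoint_rel s.1 s.2 /\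
    (2 * 3 ^+ k * k.+1%:R) ^+ 2 * B s.2 s.2 < n s.1 ^+ 2.
  move=> k; apply: contrapT => ns; apply: nC; eexists; split.
    exact: (sqr_ge0 (2 * 3 ^+ k * k.+1%:R : R)).
  by move=> e h eh; rewrite leNgt; apply/negP => lt; apply: ns; exists (e, h).
have n0 k : 0 < n (s k).1.
  rewrite lt_neqAle knorm_ge0 andbT eq_sym; apply/eqP => n0.
  have := (sP k).2; rewrite n0 expr0n /= ltNge mulr_ge0 // ?sqr_ge0 //.
have [y yP] := gliding_hump n0; have [x xy] := surjA y.
(* Then [B x x] < k+1 <= (k+1)^2. *)
pose k := Num.truncn (B x x).
have := yP k; have [rep lt] := sP k; rewrite -xy rep => nle.
have := form_cauchy_schwarz x (s k).2; rewrite -real_normK ?num_real //.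
have := n0 k; have := truncnS_gt (B x x); rewrite -/k.
have := posB x; have := posB (s k).2; have : 1 <= k.+1%:R :> R by rewrite ler1n.
have : 0 < 2 * 3 ^+ k :> R by rewrite mulr_gt0 ?exprn_gt0.
move: lt nle; set nk := n _; set c := 2 * _; set K := _%:R; set p : R := `|_|.
set q := B x x; set r := B _ _ => lt nle c0 K1 r0 q0 qK nk0 pqr.
have p0 : 0 <= p by exact: normr_ge0.
have h1 : nk ^+ 2 <= c ^+ 2 * (q * r).
  apply: (@le_trans _ _ (c ^+ 2 * p ^+ 2)); last by rewrite ler_wpM2l ?sqr_ge0.
  by rewrite -exprMn ler_pXn2r ?nnegrE ?(ltW nk0) // mulr_ge0 // ltW.
have h2 : q * ((c * K) ^+ 2 * r) <= q * nk ^+ 2 by rewrite ler_wpM2l // ltW.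
have h3 : K ^+ 2 * nk ^+ 2 <= K ^+ 2 * (c ^+ 2 * (q * r)).
  by rewrite ler_wpM2l // sqr_ge0.
have : K ^+ 2 * nk ^+ 2 <= q * nk ^+ 2 by apply: (le_trans h3); lra.
rewrite ler_pM2r ?exprn_gt0 //; nra.
Qed.

Hypothesis bA : exists2 C : R, 0 <= C & forall x, n (A x) ^+ 2 <= C * B x x.

Lemma adjoint_exists e : exists h, adjoint_rel e h.
Proof.
have [C C0 CP] := bA.
have [||||h _ hP] := @riesz_representation _ _ _ symB _ subT _
  (fun x => b (A x) e) (C * n e ^+ 2) complB.
- by move=> x _; exact: posB.
- by move=> a x y; rewrite linA (symb.2 e).
- by rewrite mulr_ge0 // sqr_ge0.
- move=> x _; rewrite -real_normK ?num_real // mulrAC.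
  apply: (@le_trans _ _ ((n (A x) * n e) ^+ 2)).
    by rewrite ler_pXn2r ?nnegrE ?mulr_ge0 ?knorm_ge0 // (knorm_form nP).
  by rewrite exprMn ler_wpM2r ?sqr_ge0.
- by exists h => x; exact: hP.
Qed.

(** If the images [h k] of [e k] are Cauchy, then so are the [e k] by [adjoint_bounded_below]; the
    adjoint relation passes to the limits because [b] and [B] are continuous in their second
    argument. *)
Lemma adjoint_range_complete :
  gauge_complete (fun x => B x x) [set h | exists e, adjoint_rel e h].
Proof.
move=> h /choice[e eh] hC; have [C [C0 CP]] := adjoint_bounded_below.
have eC : gauge_cauchy n e.
  move=> d d0; have d2 : 0 < d ^+ 2 / (C + 1) by rewrite divr_gt0 ?exprn_gt0; lra.
  have [N NP] := hC _ d2; exists N => j k Nj Nk.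
  have /CP : adjoint_rel (e j - e k) (h j - h k).
    by move=> x; rewrite (symfBr symb) (symfBr symB) (eh j) (eh k).
  have := NP j k Nj Nk; rewrite ltr_pdivlMr; last by lra.
  have := posB (h j - h k); set q := B _ _; set r := n _ => q0 q1 rC.
  by rewrite -(@ltr_pXn2r _ 2) ?nnegrE ?knorm_ge0 ?ltW //; nra.
have [e' _ ee'] := knorm_complete nP (fun=> I) eC.
have [h' _ hh'] := complB (fun=> I) hC.
exists h' => //; exists e' => x; apply/eqP; rewrite -subr_eq0; apply/eqP.
apply: (@sqr_small_eq0 _ _ (2 * n (A x) ^+ 2 + 2 * B x x)) => d d0.
(* The gauge [n] is a norm while [B x x] is a squared norm; [d' <= 1] ensures [d' ^+ 2 <= d]. *)
pose d' := Num.min 1 d; have d'0 : 0 < d' by rewrite lt_min ltr01.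
have [N NP] := ee' _ d'0; have [N' N'P] := hh' _ d0.
have := NP _ (leq_maxl N N'); have := N'P _ (leq_maxr N N').
set k := maxn N N' => kh ke.
have ke2 : n (e k - e') ^+ 2 <= d.
  have d'1 : d' <= 1 by rewrite ge_min lexx.
  have d'd : d' <= d by rewrite ge_min lexx orbT.
  apply: le_trans d'd; apply: (@le_trans _ _ (d' ^+ 2)); last by nra.
  by rewrite ler_pXn2r ?nnegrE ?knorm_ge0 // ltW.
have bP : b (A x) (e k - e') ^+ 2 <= n (A x) ^+ 2 * d.
  rewrite -real_normK ?num_real //.
  apply: (@le_trans _ _ ((n (A x) * n (e k - e')) ^+ 2)).
    by rewrite ler_pXn2r ?nnegrE ?mulr_ge0 ?knorm_ge0 // (knorm_form nP).
  by rewrite exprMn ler_wpM2l // sqr_ge0.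
have BP : B x (h k - h') ^+ 2 <= B x x * d.
  by apply: le_trans (form_cauchy_schwarz _ _) _; rewrite ler_wpM2l // ltW.
have -> : b (A x) e' - B x h' = B x (h k - h') - b (A x) (e k - e').
  by rewrite (symfBr symb) (symfBr symB) (eh k); ring.
have := sqr_ge0 (B x (h k - h') + b (A x) (e k - e')); lra.
Qed.

(* The representative u of g is orthogonal to the kernel of A, hence equals its
   projection on the closed range of the adjoint. *)
Lemma functional_factors (g : U -> R) (C : R) : scalar g -> 0 <= C ->
  (forall x, g x ^+ 2 <= C * B x x) -> (forall x, A x = 0 -> g x = 0) ->
  exists e, forall x, g x = b (A x) e.
Proof.
move=> ling C0 gC gker.
have [||u _ uP] := @riesz_representation _ _ _ symB _ subT _ g C complB ling C0.
- by move=> x _; exact: posB.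
- by move=> x _; exact: gC.
pose M := [set h | exists e, adjoint_rel e h].
have subM : real_subspace M.
  split.
    by exists 0 => x; rewrite (symfC symb) (symfC symB) (symf0l symb) (symf0l symB).
  move=> a h h' [e eh] [e' eh']; exists (a *: e + e') => x.
  by rewrite !(symfDr symb, symfDr symB, symfZr symb, symfZr symB) eh eh'.
(* Riesz on the complete range [M] gives the projection [h] of [u]: [u - h] is orthogonal to [M]. *)
have [||h [e eh] hP] := @riesz_representation _ _ _ symB _ subM _
    (B ^~ u) (B u u) adjoint_range_complete (symB.2 u) (posB u).
- by move=> x _; exact: posB.
- by move=> x _; rewrite mulrC; exact: form_cauchy_schwarz.
have Ar : A (u - h) = 0.
  (* The square of [n (A (u - h))] equals [b y (A (u - h))] for some [y]; moving [A] across, it is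
     the product of [u - h] with an element of [M], hence zero. *)
  apply: (knorm_eq0 nP); have [y [_ yA]] := knorm_symmetry nP (A (u - h)).
  have [h' yh'] := adjoint_exists y; apply/eqP; rewrite -sqrf_eq0 -yA.
  rewrite (symfC symb) yh' (symfC symB) (symfBr symB) (hP h') ?subrr //.
  by exists y.
have Brh : B (u - h) h = 0.
  by rewrite -eh Ar (symf0l symb).
have Bru : B (u - h) u = 0 by rewrite -uP // gker.
(* [B] being semidefinite, [u = h] is not claimed: [B (u - h) (u - h) = 0] gives [B x (u - h) = 0]
   by Cauchy-Schwarz. *)
exists e => x; rewrite eh uP //; apply/eqP; rewrite -subr_eq0 -(symfBr symB).
rewrite -sqrf_eq0 eq_le sqr_ge0 andbT.
apply: le_trans (form_cauchy_schwarz _ _) _.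
by rewrite (symfBr symB (u - h)) Bru Brh subrr mulr0.
Qed.
End KreinNorm.

(** * Restriction of scalars from the complex numbers to the reals *)

(** An alias of [F], so that the real scaling does not compete with the complex one. *)
Definition realify (R : realType) (F : lmodType R[i]) : Type := F.

Section Realify.
Variables (R : realType) (F : lmodType R[i]).

HB.instance Definition _ := GRing.Zmodule.on (realify F).

Let scale (a : R) (x : realify F) : realify F := (a%:C : R[i]) *: (x : F).

Let scaleA a b x : scale a (scale b x) = scale (a * b) x.
Proof. by rewrite /scale scalerA rmorphM. Qed.

Let scale1 : left_id 1 scale.
Proof. by move=> x; rewrite /scale rmorph1 scale1r. Qed.

Let scaleDr : right_distributive scale +%R.
Proof. by move=> a x y; rewrite /scale scalerDr. Qed.

Let scaleDl x : {morph scale^~ x : a b / a + b}.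
Proof. by move=> a b; rewrite /scale rmorphD scalerDl. Qed.

HB.instance Definition _ := GRing.Zmodule_isLmodule.Build R (realify F)
  scaleA scale1 scaleDr scaleDl.

Lemma realify_scaleE (a : R) (x : realify F) : a *: x = (a%:C : R[i]) *: (x : F).
Proof. by []. Qed.

End Realify.

Lemma Re_realMD (R : realType) (a : R) (z w : R[i]) :
  complex.Re (a%:C * z + w) = a * complex.Re z + complex.Re w.
Proof. by case: z w => [c d] [c' d'] /=; rewrite mul0r subr0. Qed.

Section RealPart.
Variables (R : realType) (F : lmodType R[i]) (f : {herm F}).

Definition re_form (x y : realify F) : R := complex.Re (f x y).

Lemma herm_conj x y : f x y = (f y x)^*.
Proof. by rewrite (@hermitian_subproof _ _ _ _ f) expr0 mul1r. Qed.

Lemma Im_herm_diag x : complex.Im (f x x) = 0.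
Proof.
have /(congr1 (@complex.Im R)) := herm_conj x x.
by case: (f x x) => a c /= cN; lra.
Qed.

Lemma re_form_sym : symmetric_bilinear re_form.
Proof.
split=> [x y|z a x y]; first by rewrite /re_form herm_conj; case: (f y x).
by rewrite /re_form realify_scaleE linearPl Re_realMD.
Qed.

End RealPart.

Section ComplexNorm.
Variables (R : realType) (F : normedModType R[i]).

Definition re_norm (x : realify F) : R := complex.Re `|x : F|.

Lemma re_normE (x : F) : `|x| = (re_norm x)%:C.
Proof. by rewrite /re_norm RRe_real // normr_real. Qed.

Lemma re_norm_ge0 x : 0 <= re_norm x.
Proof. by rewrite -ler0c -re_normE. Qed.

End ComplexNorm.

(** * The real Krein norm of a complex Krein space *)

Section KreinSpace.
Variables (R : realType).

(** A positive complex [e] is real; [e ^+ 2] bounds the form in [form_cauchy] and [form_cvg],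
    whereas [e] bounds the gauge here, hence the square and the square root. [h] is a plain function
    so as to cover both [f] and its opposite. *)
Lemma re_form_complete (F : lmodType R[i]) (h : F -> F -> R[i]) (M : set F) :
  (forall x, complex.Im (h x x) = 0) -> form_complete h M ->
  gauge_complete (fun x : realify F => complex.Re (h x x)) M.
Proof.
move=> Imh complM u Mu uC; have [|l Ml ul] := complM u Mu.
  move=> e; rewrite ltcE => /andP[/eqP Ime Ree].
  have [|N NP] := uC (complex.Re e ^+ 2); first by rewrite exprn_gt0.
  have -> : e = (complex.Re e)%:C by case: e Ime {Ree NP} => a c /= ->.
  by exists N => j k Nj Nk; rewrite -rmorphXn ltcE Imh eqxx NP.
exists l => // e e0; have [|N NP] := ul (Num.sqrt e)%:C.
  by rewrite ltcR sqrtr_gt0.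
exists N => k /NP; rewrite -rmorphXn /= sqr_sqrtr ?ltW //.
by rewrite ltcE => /andP[].
Qed.

Lemma subspace_realify (F : lmodType R[i]) (M : set F) :
  Defs.subspace M -> real_subspace (M : set (realify F)).
Proof. by move=> [M0 MD]; split=> // a x y; exact: MD. Qed.

Variables (F : normedModType R[i]) (f : {herm F}).
Let b := re_form f.
Let n := @re_norm R F.
Let symb : symmetric_bilinear b := re_form_sym f.

(** The fundamental symmetry sends [xp + xm] to [xp - xm]. The bound on the form combines the
    Cauchy-Schwarz inequalities of the two parts, and completeness holds componentwise. *)
Lemma krein_norm_realify : krein_space f -> krein_norm b n.
Proof.
move=> [Fp [Fm [[[subp posp complp] [subm posm complm] orth _ dec] normE]]].
have nE xp xm : Fp xp -> Fm xm -> n (xp + xm) ^+ 2 = b xp xp - b xm xm.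
  move=> Fxp Fxm; have := normE _ _ Fxp Fxm; rewrite re_normE -rmorphXn.
  by move=> /(congr1 (@complex.Re R)) /= ->; rewrite raddfB.
have rsubp := subspace_realify subp; have rsubm := subspace_realify subm.
have bp x : Fp x -> 0 <= b x x.
  move=> Fx; have [->|/(posp _ Fx)] := eqVneq x 0; first by rewrite (symf0l symb).
  by rewrite ltcE => /andP[_ /ltW].
have bm x : Fm x -> 0 <= - b x x.
  move=> Fx; have [->|/(posm _ Fx)] := eqVneq x 0.
    by rewrite (symf0l symb) oppr0.
  by rewrite ltcE => /andP[_ /ltW]; rewrite raddfN.
have b0 xp xm : Fp xp -> Fm xm -> b xp xm = 0.
  by move=> Fxp Fxm; rewrite /b /re_form orth.
have bE xp xm yp ym : Fp xp -> Fm xm -> Fp yp -> Fm ym ->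
    b (xp + xm) (yp + ym) = b xp yp + b xm ym.
  move=> Fxp Fxm Fyp Fym; rewrite (symfDl symb) !(symfDr symb) (symfC symb xm yp).
  by rewrite (b0 xp ym) // (b0 yp xm) // addr0 add0r.
split.
- by move=> x y; rewrite -lecR rmorphD /= /n -!re_normE; exact: (@ler_normD _ F x y).
- move=> a x; apply: complexI; rewrite rmorphM /= /n -!re_normE realify_scaleE normrZ.
  by rewrite normc_def /= expr0n addr0 sqrtr_sqr.
- by move=> x nx; apply/eqP; rewrite -(@normr_eq0 _ F) re_normE [re_norm x]nx.
- move=> e; have [ep [em [Fep Fem ->]]] := dec e; exists (ep - em).
  have Fem' : Fm (- em) by rewrite -sub0r; exact: real_subspaceB rsubm _ _ rsubm.1 Fem.
  split.
    apply/eqP; rewrite -(@eqrXn2 _ 2) ?re_norm_ge0 // !nE //.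
    by rewrite (symfNl symb) (symfNr symb) opprK.
  by rewrite nE // bE // (symfNl symb).
- move=> x y; have [xp [xm [Fxp Fxm ->]]] := dec x.
  have [yp [ym [Fyp Fym ->]]] := dec y.
  rewrite -(@ler_pXn2r _ 2) ?nnegrE ?mulr_ge0 ?re_norm_ge0 //.
  rewrite real_normK ?num_real // exprMn !nE // bE //.
  have symNb : symmetric_bilinear (fun x y => - b x y).
    split=> [x' y'|z a x' y' /=]; first by rewrite (symfC symb).
    by rewrite (symb.2 z a) opprD mulrN.
  have := symf_cauchy_schwarz symb rsubp bp Fxp Fyp.
  have := symf_cauchy_schwarz symNb rsubm bm Fxm Fym.
  have := bp _ Fxp; have := bp _ Fyp; have := bm _ Fxm; have := bm _ Fym.
  set p := b xp yp; set m := b xm ym; set ap := b xp xp; set am := b xm xm.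
  set cp := b yp yp; set cm := b ym ym => cm0 am0 cp0 ap0 mle ple.
  have q0 : 0 <= ap * - cm + - am * cp by rewrite addr_ge0 ?mulr_ge0.
  (* The cross term of (p + m)^2: by the two Cauchy-Schwarz inequalities and the
     arithmetic-geometric mean inequality, (2pm)^2 <= 4 (ap cp)(am cm) <= (ap cm + am cp)^2. *)
  have : 2 * (p * m) <= ap * - cm + - am * cp.
    have [pm|/ltW pm] := leP (2 * (p * m)) 0; first exact: le_trans q0.
    rewrite -(@ler_pXn2r _ 2) ?nnegrE //.
    apply: (@le_trans _ _ (4 * ((ap * cp) * (- am * - cm)))).
      have -> : (2 * (p * m)) ^+ 2 = 4 * (p ^+ 2 * (- m) ^+ 2) by ring.
      by rewrite ler_pM2l // ler_pM // sqr_ge0.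
    by have := sqr_ge0 (ap * - cm - - am * cp); lra.
  by rewrite sqrrN in mle; lra.
- move=> u _ uC; have /choice[v uv] : forall k, exists v : F * F,
      [/\ Fp v.1, Fm v.2 & u k = v.1 + v.2].
    by move=> k; have [xp [xm [? ? ?]]] := dec (u k); exists (xp, xm).
  have Fv k : Fp (v k).1 by case: (uv k).
  have Fv' k : Fm (v k).2 by case: (uv k).
  (* The squared norm of a difference is a sum of two nonnegative terms: it bounds each component
     for the Cauchy property, and is bounded by both for convergence. *)
  have nB x y xp xm yp ym : Fp xp -> Fm xm -> Fp yp -> Fm ym ->
      x = xp + xm -> y = yp + ym ->
      n (x - y) ^+ 2 = b (xp - yp) (xp - yp) - b (xm - ym) (xm - ym) /\
      0 <= b (xp - yp) (xp - yp) /\ 0 <= - b (xm - ym) (xm - ym).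
    move=> Fxp Fxm Fyp Fym -> ->.
    have Fp' := real_subspaceB rsubp Fxp Fyp.
    have Fm' := real_subspaceB rsubm Fxm Fym.
    by rewrite opprD addrACA nE //; split; last split; [|exact: bp|exact: bm].
  have Cp : gauge_cauchy (fun x : realify F => b x x) (fun k => (v k).1).
    move=> e e0; have [|N NP] := uC (Num.sqrt e); first by rewrite sqrtr_gt0.
    exists N => j k Nj Nk; have := NP j k Nj Nk.
    rewrite -(@ltr_pXn2r _ 2) ?nnegrE ?re_norm_ge0 ?sqrtr_ge0 // sqr_sqrtr ?ltW //.
    have [_ _ uj] := uv j; have [_ _ uk] := uv k.
    by have [-> [_ ?]] := nB _ _ _ _ _ _ (Fv j) (Fv' j) (Fv k) (Fv' k) uj uk; lra.
  have Cm : gauge_cauchy (fun x : realify F => - b x x) (fun k => (v k).2).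
    move=> e e0; have [|N NP] := uC (Num.sqrt e); first by rewrite sqrtr_gt0.
    exists N => j k Nj Nk; have := NP j k Nj Nk.
    rewrite -(@ltr_pXn2r _ 2) ?nnegrE ?re_norm_ge0 ?sqrtr_ge0 // sqr_sqrtr ?ltW //.
    have [_ _ uj] := uv j; have [_ _ uk] := uv k.
    by have [-> [? _]] := nB _ _ _ _ _ _ (Fv j) (Fv' j) (Fv k) (Fv' k) uj uk; lra.
  have [lp Flp lpP] := re_form_complete (Im_herm_diag f) complp Fv Cp.
  have [lm Flm lmP] : exists2 l, Fm l &
      gauge_cvg (fun x : realify F => - b x x) (fun k => (v k).2) l.
    have ImN x : complex.Im (- f x x) = 0 by rewrite raddfN /= Im_herm_diag oppr0.
    have := re_form_complete ImN complm Fv'.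
    have -> : (fun x : realify F => complex.Re (- f x x)) = (fun x => - b x x).
      by apply/funext => x; rewrite raddfN.
    exact.
  exists (lp + lm) => // e e0.
  have e2 : 0 < e ^+ 2 / 2 by rewrite divr_gt0 // exprn_gt0.
  have [N NP] := lpP _ e2; have [N' N'P] := lmP _ e2.
  exists (maxn N N') => k; rewrite geq_max => /andP[/NP kp /N'P km].
  rewrite -(@ltr_pXn2r _ 2) ?nnegrE ?re_norm_ge0 ?(ltW e0) //.
  have [_ _ uk] := uv k.
  by have [-> _] := nB _ _ _ _ _ _ (Fv k) (Fv' k) Flp Flm uk erefl; lra.
Qed.
End KreinSpace.

(** * Completeness and bounded operators over the reals *)

Section HilbertSpace.
Variables (R : realType) (H : completeNormedModType R[i]).
Variable dotH : {dot H for Num.conj}.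
Hypothesis hH : hilbert_space dotH.

Lemma re_dotE (x : H) : re_form dotH x x = re_norm x ^+ 2.
Proof.
have := hH x; rewrite re_normE -rmorphXn => /(congr1 (@complex.Re R)) /= ->.
by [].
Qed.

Lemma hilbert_gauge_complete :
  gauge_complete (fun x => re_form dotH x x) [set: realify H].
Proof.
move=> u _ uC.
have /cauchy_cvgP/cvg_ex[l ul] : cauchy (u @ \oo : set_system H).
  apply: cauchy_exP => e e0; move: (e0); rewrite ltcE => /andP[/eqP Ime Ree].
  have [|N NP] := uC (complex.Re e ^+ 2); first by rewrite exprn_gt0.
  have eE : e = (complex.Re e)%:C by case: e Ime {e0 Ree NP} => a c /= ->.
  exists (u N); exists N => // k /= Nk.
  rewrite -ball_normE /ball_ /= eE re_normE ltcR.
  have := NP N k (leqnn N) Nk; rewrite re_dotE ltr_pXn2r ?nnegrE ?re_norm_ge0 ?(ltW Ree) //.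
exists l => // e e0.
have e2 : 0 < (Num.sqrt e)%:C by rewrite ltcR sqrtr_gt0.
have /cvgrPdistC_lt /(_ _ e2) [N _ NP] := ul.
exists N => k Nk; rewrite re_dotE; have := NP k Nk.
rewrite /= re_normE ltcR -(@ltr_pXn2r _ 2) ?nnegrE ?re_norm_ge0 ?sqrtr_ge0 //.
by rewrite sqr_sqrtr ?ltW.
Qed.

End HilbertSpace.

Lemma bounded_operator_realify (R : realType) (U W : normedModType R[i])
    (A : {linear U -> W}) : bounded_operator A ->
  exists2 C : R, 0 <= C & forall x : U, re_norm (A x) <= C * re_norm x.
Proof.
(* [M] is an arbitrary complex number; comparing real parts leaves [complex.Re M], whose absolute
   value is a nonnegative bound. *)
move=> [M MP]; exists `|complex.Re M| => // x.
apply: (@le_trans _ _ (complex.Re M * re_norm x)).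
  have := MP x; rewrite !re_normE lecE => /andP[_].
  by case: (M) => a c /=; rewrite mulr0 subr0.
by rewrite ler_wpM2r ?re_norm_ge0 // ler_norm.
Qed.

Lemma linear_realify (R : realType) (U W : lmodType R[i]) (A : {linear U -> W}) :
  linear (A : realify U -> realify W).
Proof. by move=> a x y; rewrite !realify_scaleE linearP. Qed.

(** * Variational conditions for splines *)

Section Splines.
Variables (R : realType) (H K E : lmodType R[i]).
Variables (fK : {herm K}) (fE : {herm E}).
Variables (T : {linear H -> K}) (V : {linear H -> E}) (rho : R).

Lemma smoothing_functionalE z0 x : smoothing_functional fK fE T V rho z0 x =
  (re_form fK (T x) (T x) + rho * re_form fE (V x - z0) (V x - z0))%:C.
Proof.
rewrite /smoothing_functional /re_form rmorphD rmorphM /=.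
by congr (_ + _ * _); apply/eqP; rewrite eq_complex /= Im_herm_diag !eqxx.
Qed.

Lemma interpolating_splinesE w0 x : interpolating_splines fK T V w0 x <->
  V x = w0 /\ forall y, V y = w0 -> re_form fK (T x) (T x) <= re_form fK (T y) (T y).
Proof.
split=> -[Vx xmin]; split=> // y /xmin.
  by rewrite lecE => /andP[].
by rewrite lecE !Im_herm_diag eqxx.
Qed.

Hypothesis nonnegL : forall x,
  0 <= re_form fK (T x) (T x) + rho * re_form fE (V x) (V x).

Let symK := re_form_sym fK.
Let symE := re_form_sym fE.

(** For real [t], [t k + x] still interpolates [w0], so the form at its image under [T] is at least
    that at [T x]. The difference is a nonnegative quadratic polynomial in [t] without constant
    term, so its linear term vanishes. *)
Lemma interpolating_orthogonal w0 x k : interpolating_splines fK T V w0 x ->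
  V k = 0 -> re_form fK (T k) (T x) = 0.
Proof.
move=> /interpolating_splinesE[Vx xmin] Vk; apply/eqP; rewrite -sqrf_eq0 eq_le.
rewrite sqr_ge0 andbT -[leRHS](mulr0 (re_form fK (T k) (T k))).
apply: discriminant_le => [|t].
  by have := nonnegL k; rewrite Vk (symf0l symE) mulr0 addr0.
have /xmin : V (t%:C *: k + x) = w0 by rewrite linearP Vk scaler0 add0r.
rewrite linearP -[_ *: _]/(t *: (T k : realify K)).
rewrite (symfDl symK) !(symfDr symK) !(symfZl symK) !(symfZr symK).
by rewrite (symfC symK (T x)); lra.
Qed.

(* The first-order condition determines z0, and nonnegativity makes it
   sufficient. *)
Lemma interpolating_smoothing w0 x0 (e : E) : rho != 0 ->
  interpolating_splines fK T V w0 x0 ->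
  (forall x, re_form fK (T x) (T x0) = re_form fE (V x) e) ->
  interpolating_splines fK T V w0 `<=`
    smoothing_splines fK fE T V rho (w0 + (rho^-1)%:C *: e).
Proof.
move=> rho0 /interpolating_splinesE[Vx0 x0min] eP x.
move=> /interpolating_splinesE[Vx xmin] y; rewrite !smoothing_functionalE lecR.
(* All interpolating splines to [w0] share this minimal value, so the comparison can be made from
   [x0]. *)
have -> : re_form fK (T x) (T x) = re_form fK (T x0) (T x0).
  by apply/le_anti; rewrite xmin // x0min.
(* The functional at [y] minus that at [x0] is the [L]-form at [y - x0] plus twice
   [[T (y - x0), T x0] - [V (y - x0), e]] (real parts), which [eP] cancels. *)
have := nonnegL (y - x0); have := eP (y - x0); rewrite !linearB Vx Vx0.
rewrite -[_%:C *: e]/(rho^-1 *: (e : realify E)).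
have rhoK c : rho * (rho^-1 * c) = c by rewrite mulVKf.
have := rhoK (re_form fE (V y) e); have := rhoK (re_form fE w0 e).
rewrite !(symfDl symK, symfDr symK, symfNl symK, symfNr symK).
rewrite !(symfDl symE, symfDr symE, symfNl symE, symfNr symE, symfZl symE, symfZr symE).
rewrite (symfC symK (T x0) (T y)) (symfC symE e w0) (symfC symE e (V y)).
rewrite (symfC symE w0 (V y)); lra.
Qed.

End Splines.

Theorem proposition4p8 (R : realType)
    (H : completeNormedModType R[i]) (dotH : {dot H for Num.conj})
    (K E : normedModType R[i]) (fK : {herm K}) (fE : {herm E})
    (T : {linear H -> K}) (V : {linear H -> E}) (rho : R)
    (hH : hilbert_space dotH) (sepH : separable H)
    (hK : krein_space fK) (hE : krein_space fE)
    (bT : bounded_operator T) (surjT : set_surj [set: H] [set: K] T)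
    (bV : bounded_operator V) (surjV : set_surj [set: H] [set: E] V)
    (rho_neq0 : rho != 0)
    (nonnegL : nonnegative_subspace (product_form fK fE rho)
                 (range (pair_operator T V))) :
  (forall z0 : E, smoothing_splines fK fE T V rho z0 !=set0 ->
     exists w0 : E,
       interpolating_splines fK T V w0 !=set0 /\
       interpolating_splines fK T V w0 `<=` smoothing_splines fK fE T V rho z0)
  /\
  (forall w0 : E, interpolating_splines fK T V w0 !=set0 ->
     exists z0 : E,
       interpolating_splines fK T V w0 `<=` smoothing_splines fK fE T V rho z0).
Proof.
have posL x : 0 <= re_form fK (T x) (T x) + rho * re_form fE (V x) (V x).
  have := nonnegL.2 (T x, V x); rewrite /product_form /= => pos.
  have := pos (ex_intro2 _ _ x I erefl); rewrite addrC lecE => /andP[_].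
  by rewrite Re_realMD addrC.
split=> [z0 [x xmin]|w0 [x0 x0P]].
  have xsp : interpolating_splines fK T V (V x) x.
    by split=> // y Vy; have := xmin y; rewrite /smoothing_functional Vy lerD2r.
  exists (V x); split; first by exists x.
  move=> x' [Vx' x'min] y; apply: le_trans (xmin y).
  by rewrite /smoothing_functional Vx' lerD2r x'min.
have [CT CT0 CTP] := bounded_operator_realify bT.
have [CV CV0 CVP] := bounded_operator_realify bV.
have dotE := re_dotE hH.
pose g (x : realify H) : R := re_form fK (T x) (T x0).
have ling : scalar g.
  by move=> a x y; rewrite /g (linear_realify T a x y) (re_form_sym fK).2.
(* Here [A] is [V] and [B] the real inner product of [H]; the constant bounding [g] comes from the
   form bound on [K] and the boundedness of [T]. *)
have [|||||e eP] := @functional_factors _ _ _ _ (re_form_sym fE)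
  (krein_norm_realify hE) _ _ (re_form_sym dotH) _ (hilbert_gauge_complete hH)
  _ (linear_realify V) _ _ g ((CT * re_norm (T x0)) ^+ 2) ling (sqr_ge0 _).
- by move=> x; rewrite dotE sqr_ge0.
- by move=> y; have [x _ xy] := surjV y I; exists x.
- exists (CV ^+ 2) => [|x]; first exact: sqr_ge0.
  rewrite dotE -exprMn ler_pXn2r ?nnegrE ?mulr_ge0 ?re_norm_ge0 //; exact: CVP.
- move=> x; rewrite dotE -exprMn -real_normK ?num_real //.
  rewrite ler_pXn2r ?nnegrE ?mulr_ge0 ?re_norm_ge0 // mulrAC.
  apply: le_trans (knorm_form (krein_norm_realify hK) _ _) _.
  by rewrite ler_wpM2r ?re_norm_ge0; last exact: CTP.
- move=> x Vx; exact: (interpolating_orthogonal posL x0P Vx).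
by eexists; exact: interpolating_smoothing posL _ _ _ rho_neq0 x0P eP.
Qed.
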